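(* The global constants satisfy $$\mathfrak M_{\mathfrak O}=2\sqrt{1+\mathbf c_2(\mathfrak O)^2}=2\sqrt5.$$ Moreover, the polynomial $P_*(x,y)=-x^2+4xy-y^2$ is simultaneously extremal for all of the following: (i) the Markov inequality: $\max_{(x,y)\in\mathfrak O}\|\nabla P_*(x,y)\|_2=\mathfrak M_{\mathfrak O}\,\|P_*\|_{\mathfrak O}$; (ii) the relative polarization inequality: $\|\check P_*\|_{\mathfrak O,\mathrm{bil}}=\mathbf c_2(\mathfrak O)\,\|P_*\|_{\mathfrak O}$; (iii) every coefficient-norm inequality: $|P_*|_q=\mathcal C_q(\mathfrak O)\,\|P_*\|_{\mathfrak O}$ for every $1\le q\le\infty$, in particular for $q=4/3$; (iv) the canonical unconditional constant: $\|P_*^\#\|_{\mathfrak O}=\mathbf u_{\mathrm{can}}(\mathfrak O)\,\|P_*\|_{\mathfrak O}$; (v) the canonical body-relative Bohr radius: $\|P_*\|_{\mathfrak O}=1$ and $\|P_*^\#\|_{r\mathfrak O}>1$ for every $r>R_{\mathrm{can}}(\mathfrak O)$.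
   Context: $\mathfrak O:=\{(x,y)\in[0,1]^2: x+y\le\sqrt2\}$. All polynomials are real quadratic forms $P(x,y)=ax^2+bxy+cy^2$; $\|P\|_{\mathfrak O}:=\sup_{z\in\mathfrak O}|P(z)|$, and for $r>0$, $r\mathfrak O:=\{rz:z\in\mathfrak O\}$ and $\|P\|_{r\mathfrak O}:=\sup_{z\in r\mathfrak O}|P(z)|$. $\|\cdot\|_2$ is the Euclidean norm on $\mathbb R^2$. Markov constant: $\mathfrak M_{\mathfrak O}:=\max_{(x,y)\in\mathfrak O}\sup\{\|\nabla P(x,y)\|_2:\|P\|_{\mathfrak O}\le1\}$. Polarization: $\check P((x_1,y_1),(x_2,y_2))=ax_1x_2+\frac b2(x_1y_2+x_2y_1)+cy_1y_2$, $\|\check P\|_{\mathfrak O,\mathrm{bil}}:=\sup\{|\check P(z,w)|:z,w\in\mathfrak O\}$, and $\mathbf c_2(\mathfrak O):=\sup_{P\ne0}\|\check P\|_{\mathfrak O,\mathrm{bil}}/\|P\|_{\mathfrak O}$. Coefficient norms: $|P|_q:=(|a|^q+|b|^q+|c|^q)^{1/q}$ for $1\le q<\infty$, $|P|_\infty:=\max\{|a|,|b|,|c|\}$, and $\mathcal C_q(\mathfrak O):=\sup_{P\ne0}|P|_q/\|P\|_{\mathfrak O}$. Modulus polynomial: $P^\#(x,y):=|a|x^2+|b|xy+|c|y^2$. Unconditional constant: with $(m_1,m_2,m_3)=(x^2,xy,y^2)$, $\mathbf u_{\mathrm{can}}(\mathfrak O)$ is the least $C\ge1$ such that $\|\sum_{j\in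 A}\varepsilon_ja_jm_j\|_{\mathfrak O}\le C\|\sum_{j=1}^3a_jm_j\|_{\mathfrak O}$ for all $(a_1,a_2,a_3)\in\mathbb R^3$, all $A\subset\{1,2,3\}$ and all signs $\varepsilon_j\in\{-1,1\}$. Bohr radius: $R_{\mathrm{can}}(\mathfrak O):=\sup\{r>0:\|P^\#\|_{r\mathfrak O}\le1\text{ whenever }\|P\|_{\mathfrak O}\le1\}$. *)

(* Defs.v *)
From HB Require Import structures.
From mathcomp Require Import all_boot all_order all_algebra.
From mathcomp Require Import all_classical all_reals all_analysis.
Set Implicit Arguments.
Unset Strict Implicit.
Unset Printing Implicit Defensive.
Import Order.TTheory GRing.Theory Num.Theory.
Import numFieldNormedType.Exports.
Local Open Scope classical_set_scope.
Local Open Scope ring_scope.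

(* The maximum (resp. least element) of a set of reals, with value 0 when the
   set has none; unlike [sup] and [inf], it is required to belong to the set. *)
Definition max_of (R : realType) (A : set R) : R :=
  xget 0 [set m | A m /\ ubound A m].

Definition min_of (R : realType) (A : set R) : R :=
  xget 0 [set m | A m /\ lbound A m].

Definition octa {R : realType} : set (R * R) :=
  [set z | [/\ 0 <= z.1 <= 1, 0 <= z.2 <= 1 & z.1 + z.2 <= Num.sqrt 2]].

Definition dilate (R : realType) (r : R) (S : set (R * R)) : set (R * R) :=
  [set (r * z.1, r * z.2) | z in S].

Definition supnorm (R : realType) (S : set (R * R)) (f : R * R -> R) : R :=
  sup [set `|f z| | z in S].

(* The norm of the library on R * R is the max norm, so the Euclidean one is
   spelled out. *)
Definition eucl (R : realType) (v : R * R) : R :=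
  Num.sqrt (v.1 ^+ 2 + v.2 ^+ 2).

(* The quadratic form a x^2 + b x y + c y^2 is encoded by its coefficient
   vector (a, b, c). *)
Definition qform (R : realType) (a b c : R) : 'rV[R]_3 :=
  \row_(j < 3) [:: a; b; c]`_j.

Definition coefa (R : realType) (P : 'rV[R]_3) : R := P 0 (inord 0).
Definition coefb (R : realType) (P : 'rV[R]_3) : R := P 0 (inord 1).
Definition coefc (R : realType) (P : 'rV[R]_3) : R := P 0 (inord 2).

Definition qeval (R : realType) (P : 'rV[R]_3) (z : R * R) : R :=
  coefa P * z.1 ^+ 2 + coefb P * (z.1 * z.2) + coefc P * z.2 ^+ 2.

Definition qgrad (R : realType) (P : 'rV[R]_3) (z : R * R) : R * R :=
  (derive1 (fun t : R => qeval P (t, z.2)) z.1,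
   derive1 (fun t : R => qeval P (z.1, t)) z.2).

Definition markov_const (R : realType) : R :=
  max_of [set sup [set eucl (qgrad P z)
                  | P in [set P : 'rV[R]_3 | supnorm octa (qeval P) <= 1]]
         | z in octa].

Definition polar (R : realType) (P : 'rV[R]_3) (z w : R * R) : R :=
  coefa P * z.1 * w.1 + coefb P / 2 * (z.1 * w.2 + w.1 * z.2)
  + coefc P * z.2 * w.2.

Definition bilnorm (R : realType) (P : 'rV[R]_3) : R :=
  sup [set `|polar P z w| | z in octa & w in octa].

Definition polar_const (R : realType) : R :=
  sup [set bilnorm P / supnorm octa (qeval P)
      | P in [set P : 'rV[R]_3 | P != 0]].

(* Only exponents q with 1 <= q are meaningful. *)
Definition coef_norm (R : realType) (q : \bar R) (P : 'rV[R]_3) : R :=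
  match q with
  | r%:E => (`|coefa P| `^ r + `|coefb P| `^ r + `|coefc P| `^ r) `^ r^-1
  | +oo%E => Num.max `|coefa P| (Num.max `|coefb P| `|coefc P|)
  | -oo%E => 0
  end.

Definition coef_const (R : realType) (q : \bar R) : R :=
  sup [set coef_norm q P / supnorm octa (qeval P)
      | P in [set P : 'rV[R]_3 | P != 0]].

Definition modulus (R : realType) (P : 'rV[R]_3) : 'rV[R]_3 :=
  qform `|coefa P| `|coefb P| `|coefc P|.

Definition qmonom (R : realType) (j : 'I_3) (z : R * R) : R :=
  [:: z.1 ^+ 2; z.1 * z.2; z.2 ^+ 2]`_j.

Definition uncond_const (R : realType) : R :=
  min_of [set C : R | 1 <= C /\
    forall (a : 'rV[R]_3) (A : {set 'I_3}) (eps : 'I_3 -> R),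
      (forall j, eps j = 1 \/ eps j = -1) ->
      supnorm octa (fun z => \sum_(j in A) eps j * a 0 j * qmonom j z) <=
      C * supnorm octa (fun z => \sum_(j < 3) a 0 j * qmonom j z)].

Definition bohr_radius (R : realType) : R :=
  sup [set r : R | 0 < r /\
    forall P : 'rV[R]_3, supnorm octa (qeval P) <= 1 ->
      supnorm (dilate r octa) (qeval (modulus P)) <= 1].

Definition Pstar (R : realType) : 'rV[R]_3 := qform (-1) 4 (-1).

(* Main.v *)
(** Evaluating at (1,0), (0,1) and (sqrt 2/2, sqrt 2/2) shows that a form
    P = (a, b, c) of supremum norm N on the octagon satisfies |a|, |c| <= N and
    |a + b + c| <= 2N.  These three constraints alone give every sharp upper
    bound: |b| <= 4N, hence the coefficient norms and P^# <= 3N (attained at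
    the diagonal point); the gradient bound 2 sqrt 5 N (attained at (1,0)); and
    the polar bound 2N (attained at ((1,0),(0,1))).  The form P_* turns the
    constraints into the equalities a = c = -1, a + b + c = 2. *)
Require Import Defs.
From mathcomp Require Import all_boot all_order all_algebra.
From mathcomp Require Import all_classical all_reals all_analysis.
From mathcomp Require Import ring lra.
Import Order.TTheory GRing.Theory Num.Theory.
Import numFieldNormedType.Exports.
Local Open Scope classical_set_scope.
Local Open Scope ring_scope.

(** * Suprema, attained extrema and sup norms *)

Lemma sup_eq_max (R : realType) (A : set R) (m : R) :
  A m -> ubound A m -> sup A = m.
Proof.
move=> Am ubm; apply/le_anti; rewrite (ge_sup _ ubm) /=; last by exists m.
by apply: ub_le_sup => //; exists m.
Qed.

Lemma max_of_eq (R : realType) (A : set R) (m : R) :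
  A m -> ubound A m -> max_of A = m.
Proof.
move=> Am ubm; apply: xget_unique => //= y [Ay uby].
by apply/le_anti; rewrite ubm // uby.
Qed.

Lemma min_of_eq (R : realType) (A : set R) (m : R) :
  A m -> lbound A m -> min_of A = m.
Proof.
move=> Am lbm; apply: xget_unique => //= y [Ay lby].
by apply/le_anti; rewrite lbm // lby.
Qed.

Lemma supnorm_le (R : realType) (S : set (R * R)) (f : R * R -> R) (M : R) :
  S !=set0 -> (forall z, S z -> `|f z| <= M) -> supnorm S f <= M.
Proof.
move=> [z Sz] fM; apply: ge_sup; first by exists `|f z|, z.
by move=> _ [w Sw <-]; exact: fM.
Qed.

(** The bound [M] certifies that the set of values is bounded above; on an unbounded set [sup] would
    be a default value. *)
Lemma ge_supnorm (R : realType) (S : set (R * R)) (f : R * R -> R) (M : R) z :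
  (forall z, S z -> `|f z| <= M) -> S z -> `|f z| <= supnorm S f.
Proof.
move=> fM Sz; apply: ub_le_sup; last by exists z.
by exists M => _ [w Sw <-]; exact: fM.
Qed.

Lemma supnorm_eq (R : realType) (S : set (R * R)) (f : R * R -> R) (M : R) z :
  S z -> `|f z| = M -> (forall z, S z -> `|f z| <= M) -> supnorm S f = M.
Proof.
move=> Sz fz fM; apply: sup_eq_max; first by exists z.
by move=> _ [w Sw <-]; exact: fM.
Qed.

(** * The octagon and its test points *)

Lemma sqr_sqrt2 (R : realType) : Num.sqrt 2 ^+ 2 = 2 :> R.
Proof. by rewrite sqr_sqrtr. Qed.

Lemma sqrt2_bounds (R : realType) : 1 <= Num.sqrt 2 :> R /\ Num.sqrt 2 <= 3 / 2 :> R.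
Proof.
have := sqr_sqrt2 R; have := sqrtr_ge0 (2 : R); rewrite expr2 => h0 h2.
by split; nra.
Qed.

Lemma octa10 (R : realType) : octa (1 : R, 0 : R).
Proof. by have [h1 h2] := sqrt2_bounds R; split => /=; lra. Qed.

Lemma octa01 (R : realType) : octa (0 : R, 1 : R).
Proof. by have [h1 h2] := sqrt2_bounds R; split => /=; lra. Qed.

Lemma octa_diag (R : realType) : octa (Num.sqrt 2 / 2 : R, Num.sqrt 2 / 2 : R).
Proof. by have [h1 h2] := sqrt2_bounds R; split => /=; lra. Qed.

(** Squaring the slanted-edge constraint removes the irrational constant, which leaves polynomial
    inequalities for [nra] and [lra]. *)
Lemma octa_sum_sqr (R : realType) (z : R * R) : octa z -> (z.1 + z.2) ^+ 2 <= 2.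
Proof.
case: z => x y [/= hx hy hs]; rewrite -[leRHS](sqr_sqrt2 R).
by apply: lerXn2r; rewrite ?nnegrE ?sqrtr_ge0 //; lra.
Qed.

(** * Coefficients of a form and their bounds by its norm *)

Lemma coefa_qform (R : realType) (a b c : R) : coefa (qform a b c) = a.
Proof. by rewrite /coefa mxE /= inordK. Qed.

Lemma coefb_qform (R : realType) (a b c : R) : coefb (qform a b c) = b.
Proof. by rewrite /coefb mxE /= inordK. Qed.

Lemma coefc_qform (R : realType) (a b c : R) : coefc (qform a b c) = c.
Proof. by rewrite /coefc mxE /= inordK. Qed.

Definition coef_qform := (coefa_qform, coefb_qform, coefc_qform).

Lemma row3_eq0 (R : realType) (P : 'rV[R]_3) :
  coefa P = 0 -> coefb P = 0 -> coefc P = 0 -> P = 0.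
Proof.
move=> a0 b0 c0; apply/rowP => j; rewrite mxE -[j]inord_val.
by case: j => [[|[|[|j]]] lj].
Qed.

(** All monomials lie in [0,1] on the octagon. This crude bound makes the norm of every form a
    genuine supremum. *)
Lemma normr_qeval_le (R : realType) (P : 'rV[R]_3) (z : R * R) : octa z ->
  `|qeval P z| <= `|coefa P| + `|coefb P| + `|coefc P|.
Proof.
have M (a u : R) : 0 <= u <= 1 -> `|a * u| <= `|a|.
  by case/andP=> u0 u1; rewrite normrM (ger0_norm u0) ler_piMr.
case: z => x y [/= /andP[x0 x1] /andP[y0 y1] _].
rewrite /qeval /= (le_trans (ler_normD _ _)) // lerD //; last first.
  by apply: M; rewrite exprn_ge0 // exprn_ile1.
rewrite (le_trans (ler_normD _ _)) // lerD //.
  by apply: M; rewrite exprn_ge0 // exprn_ile1.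
by apply: M; rewrite mulr_ge0 // mulr_ile1.
Qed.

Lemma ge_supnorm_octa (R : realType) (P : 'rV[R]_3) (z : R * R) :
  octa z -> `|qeval P z| <= supnorm octa (qeval P).
Proof. by apply: ge_supnorm => w; exact: normr_qeval_le. Qed.

Lemma supnorm_octa_ge0 (R : realType) (P : 'rV[R]_3) :
  0 <= supnorm octa (qeval P).
Proof. by apply: le_trans (ge_supnorm_octa _ P _ (octa10 R)). Qed.

Lemma normr_coefa_le (R : realType) (P : 'rV[R]_3) :
  `|coefa P| <= supnorm octa (qeval P).
Proof.
have := ge_supnorm_octa _ P _ (octa10 R).
by congr (`|_| <= _); rewrite /qeval /=; ring.
Qed.

Lemma normr_coefc_le (R : realType) (P : 'rV[R]_3) :
  `|coefc P| <= supnorm octa (qeval P).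
Proof.
have := ge_supnorm_octa _ P _ (octa01 R).
by congr (`|_| <= _); rewrite /qeval /=; ring.
Qed.

Lemma normr_coef_sum_le (R : realType) (P : 'rV[R]_3) :
  `|coefa P + coefb P + coefc P| <= 2 * supnorm octa (qeval P).
Proof.
have := ge_supnorm_octa _ P _ (octa_diag R).
(* All three monomials equal 1/2 at the diagonal point. *)
have -> : qeval P (Num.sqrt 2 / 2, Num.sqrt 2 / 2)
    = (coefa P + coefb P + coefc P) / 2.
  by rewrite /qeval /= !expr_div_n sqr_sqrt2 mulrACA -expr2 sqr_sqrt2; field.
by rewrite normrM [X in _ * X]ger0_norm; lra.
Qed.

(** Write b = (a + b + c) - a - c; the factor is 4 = 2 + 1 + 1. *)
Lemma normr_coefb_le (R : realType) (P : 'rV[R]_3) :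
  `|coefb P| <= 4 * supnorm octa (qeval P).
Proof.
have := normr_coefa_le _ P; have := normr_coefc_le _ P.
have := normr_coef_sum_le _ P; rewrite !ler_norml; lra.
Qed.

Lemma supnorm_octa_gt0 (R : realType) (P : 'rV[R]_3) :
  P != 0 -> 0 < supnorm octa (qeval P).
Proof.
rewrite lt_def supnorm_octa_ge0 andbT; apply: contra => /eqP N0.
have := normr_coefa_le _ P; have := normr_coefc_le _ P.
have := normr_coefb_le _ P; rewrite N0 mulr0 !normr_le0.
by move=> /eqP b0 /eqP c0 /eqP a0; rewrite (row3_eq0 _ _ a0 b0 c0).
Qed.

(** * The modulus polynomial *)

Lemma qeval_modulus_ge0 (R : realType) (P : 'rV[R]_3) (z : R * R) :
  octa z -> 0 <= qeval (modulus P) z.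
Proof.
move=> [/= /andP[x0 _] /andP[y0 _] _]; rewrite /qeval !coef_qform.
by rewrite !addr_ge0 // mulr_ge0 ?exprn_ge0 // mulr_ge0.
Qed.

Lemma qeval_modulus_le (R : realType) (P : 'rV[R]_3) (z : R * R) :
  octa z -> qeval (modulus P) z <= 3 * supnorm octa (qeval P).
Proof.
rewrite /qeval !coef_qform => oz; have := octa_sum_sqr _ _ oz.
case: oz => /= /andP[x0 _] /andP[y0 _] _.
have := normr_coefa_le _ P; have := normr_coefc_le _ P.
have := normr_coefb_le _ P; have := supnorm_octa_ge0 _ P.
set N := supnorm _ _; move: z.1 z.2 x0 y0 => x y x0 y0 N0 b4 c1 a1 s2.
have xy0 : 0 <= x * y by exact: mulr_ge0.
(* The coefficient bounds N, 4N, N are inserted; then x^2 + 4xy + y^2 = 3(x+y)^2/2 - (x-y)^2/2 <=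
   3. *)
apply: (@le_trans _ _ (N * (x ^+ 2 + 4 * (x * y) + y ^+ 2))).
  rewrite !mulrDr [N * (4 * _)]mulrA [N * 4]mulrC !lerD // ?ler_wpM2r ?exprn_ge0 //.
rewrite [leRHS]mulrC ler_wpM2l //.
by have := sqr_ge0 (x - y); move: s2; rewrite !expr2; nra.
Qed.

(** * The gradient bound *)

Lemma grad_sqr_le_ordered (R : realType) (N a b c x y : R) :
  `|a| <= N -> `|c| <= N -> `|a + b + c| <= 2 * N ->
  0 <= y <= x -> x <= 1 -> (x + y) ^+ 2 <= 2 ->
  (2 * a * x + b * y) ^+ 2 + (b * x + 2 * c * y) ^+ 2 <= 20 * N ^+ 2.
Proof.
move=> /ler_normlP[a1 a2] /ler_normlP[c1 c2] /ler_normlP[s1 s2] /andP[y0 yx] x1 xy2.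
have N0 : 0 <= N by lra.
(* Eliminating b through |a + b + c| <= 2N bounds the two components of the
   gradient by 2(x+y)N and max(2(x+y), 4x-2y)N respectively. *)
have U : (2 * a * x + b * y) ^+ 2 <= (2 * N * (x + y)) ^+ 2.
  rewrite -[leLHS]real_normK ?num_real // lerXn2r ?nnegrE //; first nra.
  by rewrite ler_norml; nra.
(* In b x + 2 c y = (a+b+c) x - a x + c (2y - x), the sign of the weight of c decides which of the
   two bounds applies. *)
have [yx2|xy2'] := leP (2 * y) x.
  have V : (b * x + 2 * c * y) ^+ 2 <= (N * (4 * x - 2 * y)) ^+ 2.
    rewrite -[leLHS]real_normK ?num_real // lerXn2r ?nnegrE //; first nra.
    by rewrite ler_norml; nra.
  apply: le_trans (lerD U V) _; rewrite !exprMn.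
  (* The left side is 20x^2 - 8y(x - y), with y <= x <= 1; equality holds at (1,0). *)
  have : 4 * (x + y) ^+ 2 + (4 * x - 2 * y) ^+ 2 <= 20 by nra.
  by have := sqr_ge0 N; nra.
have V : (b * x + 2 * c * y) ^+ 2 <= (2 * N * (x + y)) ^+ 2.
  rewrite -[leLHS]real_normK ?num_real // lerXn2r ?nnegrE //; first nra.
  by rewrite ler_norml; nra.
(* Here the sum is 8 N^2 (x+y)^2 <= 16 N^2. *)
apply: le_trans (lerD U V) _; rewrite !exprMn.
by have := sqr_ge0 N; nra.
Qed.

Lemma grad_sqr_le (R : realType) (P : 'rV[R]_3) (z : R * R) : octa z ->
  (2 * coefa P * z.1 + coefb P * z.2) ^+ 2
  + (coefb P * z.1 + 2 * coefc P * z.2) ^+ 2 <= 20 * supnorm octa (qeval P) ^+ 2.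
Proof.
move=> oz; have := octa_sum_sqr _ _ oz.
case: oz => /= /andP[x0 x1] /andP[y0 y1] _ s2.
have ha := normr_coefa_le _ P; have hc := normr_coefc_le _ P.
have hs := normr_coef_sum_le _ P.
have [yx|xy] := leP z.2 z.1.
  by apply: grad_sqr_le_ordered => //; rewrite y0.
(* Exchanging x with y and a with c preserves the three constraints and swaps the gradient
   components. *)
rewrite addrC [coefb P * z.1 + _]addrC [2 * _ * z.1 + _]addrC.
apply: grad_sqr_le_ordered => //; last by rewrite addrC.
  by rewrite addrC addrA addrAC.
by rewrite x0 ltW.
Qed.

(** * The polarization bound *)

(** With m = [z.1 * w.2 + w.1 * z.2], eliminating b gives polar P z w = (a+b+c) m/2 + a (z.1 w.1 -
    m/2) + c (z.2 w.2 - m/2). The three constraints bound this by N times the left-hand side. *)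
Lemma polar_weight_le (R : realType) (z w : R * R) : octa z -> octa w ->
  z.1 * w.2 + w.1 * z.2 + `|z.1 * w.1 - (z.1 * w.2 + w.1 * z.2) / 2|
    + `|z.2 * w.2 - (z.1 * w.2 + w.1 * z.2) / 2| <= 2.
Proof.
have [] := sqrt2_bounds R; have := sqr_sqrt2 R.
case: z w => [x y] [u v]; rewrite /octa /=; move: (Num.sqrt 2) => t tt t1 t2.
case=> /andP[x0 x1] /andP[y0 y1] xy [/andP[u0 u1] /andP[v0 v1] uv].
(* One inequality for each choice of the signs of the two absolute values; the
   mixed ones are Cauchy-Schwarz, as x^2 + y^2 <= x + y <= sqrt 2. *)
have zz : x ^+ 2 + y ^+ 2 <= t by nra.
have ww : u ^+ 2 + v ^+ 2 <= t by nra.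
have zw : (x ^+ 2 + y ^+ 2) * (u ^+ 2 + v ^+ 2) <= t * t by nra.
(* In both applications [q] completes [p] so that p^2 + q^2 = 2 (x^2 + y^2)(u^2 + v^2), and [t * t]
   is 2. *)
have mixed p q : (p ^+ 2 + q ^+ 2 <= 2 * (t * t)) -> p <= 2 by nra.
have pp : x * u + y * v <= 2 by nra.
have pm : x * v + u * y + x * u - y * v <= 2.
  apply: (mixed _ (x * u - x * v - y * u - y * v)).
  by apply: le_trans (_ : 2 * ((x ^+ 2 + y ^+ 2) * (u ^+ 2 + v ^+ 2)) <= _); lra.
have mp : x * v + u * y - x * u + y * v <= 2.
  apply: (mixed _ (x * u + x * v + y * u - y * v)).
  by apply: le_trans (_ : 2 * ((x ^+ 2 + y ^+ 2) * (u ^+ 2 + v ^+ 2)) <= _); lra.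
have mm : 2 * (x * v + u * y) - x * u - y * v <= 2.
  (* The expression is u (2y - x) + v (2x - y). A negative weight is dropped and a nonnegative one
     is taken at u = 1 or v = 1, which leaves 2x - y, 2y - x or x + y. *)
  have [xy2|xy2] := leP (2 * y) x; last have [yx2|yx2] := leP (2 * x) y.
  - have := mulr_ge0 u0 (_ : 0 <= x - 2 * y).
    have := mulr_ge0 (_ : 0 <= 1 - v) (_ : 0 <= 2 * x - y); lra.
  - have := mulr_ge0 v0 (_ : 0 <= y - 2 * x).
    have := mulr_ge0 (_ : 0 <= 1 - u) (_ : 0 <= 2 * y - x); lra.
  - have := mulr_ge0 (_ : 0 <= 1 - u) (_ : 0 <= 2 * y - x).
    have := mulr_ge0 (_ : 0 <= 1 - v) (_ : 0 <= 2 * x - y); lra.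
by case: (ler0P (x * u - _)); case: (ler0P (y * v - _)); lra.
Qed.

Lemma normr_polar_le (R : realType) (P : 'rV[R]_3) (z w : R * R) :
  octa z -> octa w -> `|polar P z w| <= 2 * supnorm octa (qeval P).
Proof.
move=> oz ow; have := polar_weight_le _ _ _ oz ow.
case: oz ow => [/= /andP[x0 _] /andP[y0 _] _] [/= /andP[u0 _] /andP[v0 _] _].
set m := z.1 * w.2 + w.1 * z.2; rewrite [X in X + _ + _](splitr m) => W.
have N0 := supnorm_octa_ge0 _ P.
have -> : polar P z w = (coefa P + coefb P + coefc P) * (m / 2)
   + coefa P * (z.1 * w.1 - m / 2) + coefc P * (z.2 * w.2 - m / 2).
  by rewrite /polar -/m; field.
have m0 : 0 <= m / 2 by rewrite divr_ge0 // addr_ge0 // mulr_ge0.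
apply: le_trans (ler_normD _ _) _; apply: le_trans (lerD (ler_normD _ _) (lexx _)) _.
move: (m / 2) m0 W => k k0 W.
rewrite !normrM (ger0_norm k0) mulrC.
have := ler_wpM2l k0 (normr_coef_sum_le _ P).
have := ler_wpM2r (normr_ge0 (z.1 * w.1 - k)) (normr_coefa_le _ P).
have := ler_wpM2r (normr_ge0 (z.2 * w.2 - k)) (normr_coefc_le _ P).
have := ler_wpM2l N0 W.
rewrite !mulrDr; lra.
Qed.

(** * Partial derivatives of a form *)

Lemma derive1_trinomial (R : realType) (a b c x : R) :
  derive1 (fun t => a * t ^+ 2 + b * t + c) x = 2 * a * x + b.
Proof.
have -> : (fun t => a * t ^+ 2 + b * t + c) = a *: (id ^+ 2) + b *: id + cst c.
  by apply/funext => t; rewrite !fctE.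
have D := is_deriveD (is_deriveD (is_deriveZ a (is_deriveX 2 (is_derive_id x 1)))
  (is_deriveZ b (is_derive_id x 1))) (is_derive_cst c x 1).
rewrite derive1E (@derive_val _ _ _ _ _ _ _ D) expr1 addr0.
rewrite /GRing.scale /= !mulr1.
by rewrite mulrA [a * 2]mulrC.
Qed.

Lemma qgradE (R : realType) (P : 'rV[R]_3) (z : R * R) :
  qgrad P z = (2 * coefa P * z.1 + coefb P * z.2,
               coefb P * z.1 + 2 * coefc P * z.2).
Proof.
rewrite /qgrad.
have -> : (fun t => qeval P (t, z.2)) =
    (fun t => coefa P * t ^+ 2 + coefb P * z.2 * t + coefc P * z.2 ^+ 2).
  by apply/funext => t; rewrite /qeval /= mulrA mulrAC.
have -> : (fun t => qeval P (z.1, t)) =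
    (fun t => coefc P * t ^+ 2 + coefb P * z.1 * t + coefa P * z.1 ^+ 2).
  by apply/funext => t; rewrite /qeval /= mulrA addrC addrA addrAC.
by rewrite !derive1_trinomial [_ + coefb P * z.1]addrC.
Qed.

Lemma eucl_qgrad_le (R : realType) (P : 'rV[R]_3) (z : R * R) : octa z ->
  eucl (qgrad P z) <= 2 * Num.sqrt 5 * supnorm octa (qeval P).
Proof.
move=> oz; rewrite -[leRHS]ger0_norm; last first.
  by rewrite mulr_ge0 ?supnorm_octa_ge0 // mulr_ge0 ?sqrtr_ge0.
rewrite -sqrtr_sqr /eucl ler_wsqrtr // qgradE /=.
apply: le_trans (grad_sqr_le _ _ _ oz) _.
by rewrite !exprMn sqr_sqrtr // -natrX -natrM.
Qed.

(** * The extremal form and the Markov constant *)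

Lemma supnorm_Pstar (R : realType) : supnorm octa (qeval (Pstar R)) = 1.
Proof.
apply: (supnorm_eq _ _ _ _ _ (octa10 R)).
  by rewrite /qeval !coef_qform /= expr1n !mulr0 expr0n mulr0 mulr1 !addr0 normrN1.
move=> [x y] oz; have := octa_sum_sqr _ _ oz.
case: oz => /= /andP[x0 x1] /andP[y0 y1] _ s2.
(* Above: -x^2 + 4xy - y^2 = (x+y)^2/2 - 3(x-y)^2/2 <= 1. Below: if x <= y then x^2 <= xy, so the
   form is at least -y^2 >= -1; the other case is symmetric. *)
rewrite /qeval !coef_qform /= ler_norml; apply/andP; split; last first.
  by have := sqr_ge0 (x - y); lra.
by have [xy|yx] := leP x y; nra.
Qed.

Lemma supnorm_modulus_Pstar (R : realType) :
  supnorm octa (qeval (modulus (Pstar R))) = 3.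
Proof.
apply: (supnorm_eq _ _ _ _ _ (octa_diag R)).
  rewrite (ger0_norm (qeval_modulus_ge0 _ _ _ (octa_diag R))).
  rewrite /qeval !coef_qform /= normrN1 ger0_norm // !expr_div_n sqr_sqrt2.
  by rewrite mulrACA -expr2 sqr_sqrt2; field.
move=> z oz; rewrite ger0_norm ?qeval_modulus_ge0 //.
by have := qeval_modulus_le _ (Pstar R) _ oz; rewrite supnorm_Pstar mulr1.
Qed.

Lemma eucl_qgrad_Pstar (R : realType) :
  eucl (qgrad (Pstar R) (1, 0)) = 2 * Num.sqrt 5.
Proof.
rewrite qgradE !coef_qform /eucl /=.
rewrite -[RHS]ger0_norm ?mulr_ge0 ?sqrtr_ge0 // -sqrtr_sqr exprMn sqr_sqrtr //.
by congr Num.sqrt; ring.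
Qed.

Lemma markov_constE (R : realType) : markov_const R = 2 * Num.sqrt 5.
Proof.
have le_grad z P : octa z -> supnorm octa (qeval P) <= 1 ->
    eucl (qgrad P z) <= 2 * Num.sqrt 5 :> R.
  move=> oz P1; apply: le_trans (eucl_qgrad_le _ _ _ oz) _.
  by rewrite -[leRHS]mulr1 ler_wpM2l // mulr_ge0 ?sqrtr_ge0.
apply: max_of_eq.
  (* The outer maximum is attained at (1,0), and the inner supremum there at [Pstar]. *)
  exists (1, 0); first exact: octa10.
  apply: sup_eq_max => [|_ [P /= P1 <-]]; last first.
    by apply: le_grad => //; exact: octa10.
  by exists (Pstar R); rewrite /= ?supnorm_Pstar ?eucl_qgrad_Pstar.
move=> _ [z oz <-]; apply: ge_sup.
  by exists (eucl (qgrad (Pstar R) z)), (Pstar R); rewrite //= supnorm_Pstar.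
by move=> _ [P /= P1 <-]; exact: le_grad.
Qed.

(** * Polarization and coefficient constants as suprema of ratios *)

Lemma Pstar_neq0 (R : realType) : Pstar R != 0.
Proof.
apply/eqP => P0; have := coefa_qform _ (-1 : R) 4 (-1).
by rewrite -/(Pstar R) P0 /coefa mxE => /eqP; rewrite eq_sym oppr_eq0 oner_eq0.
Qed.

(** Since [Pstar] has norm 1, its ratio is [f (Pstar R)] itself. This serves both the polarization
    and the coefficient constants. *)
Lemma sup_ratio_Pstar (R : realType) (f : 'rV[R]_3 -> R) :
  (forall P, f P <= f (Pstar R) * supnorm octa (qeval P)) ->
  sup [set f P / supnorm octa (qeval P) | P in [set P : 'rV[R]_3 | P != 0]]
    = f (Pstar R).
Proof.
move=> fP; apply: sup_eq_max.
  by exists (Pstar R); rewrite /= ?Pstar_neq0 // supnorm_Pstar divr1.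
by move=> _ [P /= P0 <-]; rewrite ler_pdivrMr ?supnorm_octa_gt0.
Qed.

Lemma bilnorm_le (R : realType) (P : 'rV[R]_3) :
  bilnorm P <= 2 * supnorm octa (qeval P).
Proof.
apply: ge_sup => [|_ [z oz [w ow <-]]]; last exact: normr_polar_le.
exists `|polar P (1, 0) (1, 0)|, (1, 0); first exact: octa10.
by exists (1, 0) => //; exact: octa10.
Qed.

Lemma bilnorm_Pstar (R : realType) : bilnorm (Pstar R) = 2.
Proof.
apply: sup_eq_max.
  exists (1, 0); first exact: octa10.
  exists (0, 1); first exact: octa01.
  rewrite /polar !coef_qform /=.
  by rewrite !(mulr0, mul0r, mulr1, mul1r, addr0, add0r) ger0_norm; lra.
move=> _ [z oz [w ow <-]].
by have := normr_polar_le _ (Pstar R) _ _ oz ow; rewrite supnorm_Pstar mulr1.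
Qed.

Lemma polar_constE (R : realType) : polar_const R = 2.
Proof.
rewrite /polar_const sup_ratio_Pstar ?bilnorm_Pstar // => P.
exact: bilnorm_le.
Qed.

(** The vector (|a|, |b|, |c|) is dominated entrywise by N (1, 4, 1), and every such norm is
    monotone and homogeneous. *)
Lemma coef_norm_le_Pstar (R : realType) (q : \bar R) (P : 'rV[R]_3) :
  (1 <= q)%E ->
  coef_norm q P <= coef_norm q (Pstar R) * supnorm octa (qeval P).
Proof.
have := normr_coefa_le _ P; have := normr_coefb_le _ P.
have := normr_coefc_le _ P; have := supnorm_octa_ge0 _ P.
set N := supnorm _ _ => N0 c1 b4 a1.
case: q => [r||] //=; rewrite !coef_qform normrN1 normr_nat; last first.
  move=> _; rewrite [Num.max 4 1]max_l ?[Num.max 1 4]max_r ?ler1n //.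
  by rewrite !ge_max b4 /=; lra.
rewrite lee_fin => r1; have r0 : 0 <= r by lra.
set S := (X in _ <= X `^ _ * _).
have S0 : 0 <= S by rewrite !addr_ge0 ?powR_ge0.
have -> : S `^ r^-1 * N = (S * N `^ r) `^ r^-1.
  by rewrite powRM ?powR_ge0 // -powRrM mulfV ?powRr1 //; lra.
have mono (u v : R) : 0 <= u -> u <= v -> u `^ r <= v `^ r.
  by move=> u0 uv; rewrite ge0_ler_powR // nnegrE (le_trans u0).
apply: ge0_ler_powR; rewrite ?invr_ge0 ?nnegrE ?mulr_ge0 ?addr_ge0 ?powR_ge0 //.
rewrite /S !mulrDl -!powRM // mul1r; apply: lerD; [apply: lerD|]; exact: mono.
Qed.

Lemma coef_constE (R : realType) (q : \bar R) :
  (1 <= q)%E -> coef_const q = coef_norm q (Pstar R).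
Proof. by move=> q1; apply: sup_ratio_Pstar => P; exact: coef_norm_le_Pstar. Qed.

(** * The unconditional constant *)

Lemma qevalE (R : realType) (a : 'rV[R]_3) (z : R * R) :
  qeval a z = \sum_(j < 3) a 0 j * qmonom j z.
Proof.
rewrite !big_ord_recl big_ord0 /qeval /coefa /coefb /coefc addr0 addrA /qmonom /=.
by congr (a 0 _ * _ + a 0 _ * _ + a 0 _ * _); apply/val_inj; rewrite /= inordK.
Qed.

(** The monomials are nonnegative on the octagon, so after any choice of signs and omissions the sum
    stays below the modulus polynomial, hence below 3N. *)
Lemma uncond_constE (R : realType) : uncond_const R = 3.
Proof.
apply: min_of_eq.
  split=> [|a A eps heps]; first by rewrite ler1n.
  have <- : qeval a = (fun z => \sum_(j < 3) a 0 j * qmonom j z).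
    by apply/funext => z; exact: qevalE.
  apply: supnorm_le => [|z oz]; first by exists (1, 0); exact: octa10.
  apply: le_trans (qeval_modulus_le _ a _ oz).
  rewrite qevalE; apply: le_trans (ler_norm_sum _ _ _) _.
  rewrite big_mkcond ler_sum // => j _.
  have mj : 0 <= qmonom j z.
    case: oz => [/= /andP[x0 _] /andP[y0 _] _]; rewrite /qmonom.
    by case: j => [[|[|[|j]]] lj] //=; rewrite ?exprn_ge0 ?mulr_ge0.
  have -> : modulus a 0 j = `|a 0 j|.
    rewrite mxE -[in RHS](inord_val j).
    by case: j {mj} => [[|[|[|j]]] lj].
  case: ifP => _; last by rewrite mulr_ge0.
  rewrite !normrM (ger0_norm mj).
  by case: (heps j) => ->; rewrite ?normrN1 ?normr1 mul1r.
(* The signs (-1, 1, -1) turn [Pstar] into its modulus, of norm 3, which forces C >= 3. *)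
pose eps (j : 'I_3) : R := if j == 1 :> nat then 1 else -1.
move=> C [_ /(_ (Pstar R) [set: 'I_3]%SET eps)].
have <- : qeval (Pstar R) = (fun z => \sum_(j < 3) Pstar R 0 j * qmonom j z).
  by apply/funext => z; exact: qevalE.
rewrite [X in supnorm _ X <= _](_ : _ = qeval (modulus (Pstar R))); last first.
  apply/funext => z; rewrite qevalE; apply: eq_big => j; first by rewrite inE.
  move=> _; congr (_ * _); rewrite !mxE !coef_qform /eps.
  case: j => [[|[|[|j]]] lj] //=.
  - by rewrite normrN1 mulrNN mulr1.
  - by rewrite ger0_norm // mul1r.
  - by rewrite normrN1 mulrNN mulr1.
rewrite supnorm_Pstar supnorm_modulus_Pstar mulr1; apply => j.
by rewrite /eps; case: ifP; [left|right].
Qed.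

(** * Dilation and the Bohr radius *)

Lemma qeval_dilate (R : realType) (P : 'rV[R]_3) (r : R) (z : R * R) :
  qeval P (r * z.1, r * z.2) = r ^+ 2 * qeval P z.
Proof. by rewrite /qeval /=; ring. Qed.

Lemma normr_modulus_dilate_le (R : realType) (P : 'rV[R]_3) (r : R) (z : R * R) :
  dilate r octa z ->
  `|qeval (modulus P) z| <= r ^+ 2 * (3 * supnorm octa (qeval P)).
Proof.
move=> [w ow <-]; rewrite qeval_dilate normrM ger0_norm ?sqr_ge0 //.
by rewrite ler_wpM2l ?sqr_ge0 // ger0_norm ?qeval_modulus_ge0 ?qeval_modulus_le.
Qed.

Lemma supnorm_modulus_Pstar_dilate_ge (R : realType) (r : R) :
  3 * r ^+ 2 <= supnorm (dilate r octa) (qeval (modulus (Pstar R))).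
Proof.
have oz : dilate r octa (r * (Num.sqrt 2 / 2), r * (Num.sqrt 2 / 2)).
  by exists (Num.sqrt 2 / 2, Num.sqrt 2 / 2) => //; exact: octa_diag.
apply: le_trans (ge_supnorm _ _ _ _ _ (normr_modulus_dilate_le _ (Pstar R) r) oz).
rewrite (qeval_dilate _ _ _ (Num.sqrt 2 / 2, Num.sqrt 2 / 2)).
apply: le_trans (ler_norm _); rewrite mulrC ler_wpM2l ?sqr_ge0 //.
rewrite /qeval !coef_qform /= normrN1 ger0_norm // !expr_div_n sqr_sqrt2.
by rewrite mulrACA -expr2 sqr_sqrt2; lra.
Qed.

(** On the r-dilate the modulus is at most 3 r^2 N, which is at most 1 for r^2 = 1/3 and N <= 1.
    Thus any r beyond the Bohr radius has 3 r^2 > 1, a lower bound for the norm of the modulus of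
    [Pstar] there. *)
Lemma le_bohr_radius (R : realType) : Num.sqrt 3^-1 <= bohr_radius R.
Proof.
have i0 : 0 < 3^-1 :> R by rewrite invr_gt0.
apply: ub_le_sup.
  (* Testing on [Pstar] gives 3 r^2 <= 1, so the admissible radii are bounded by 1 and [sup] is
     genuine. *)
  exists 1 => r [r0 /(_ (Pstar R))]; rewrite supnorm_Pstar => /(_ (lexx _)).
  move/(le_trans (supnorm_modulus_Pstar_dilate_ge _ _)); rewrite expr2; nra.
split=> [|P P1]; first by rewrite sqrtr_gt0.
apply: supnorm_le => [|z oz].
  by exists (Num.sqrt 3^-1 * 1, Num.sqrt 3^-1 * 0), (1, 0) => //; exact: octa10.
apply: le_trans (normr_modulus_dilate_le _ _ _ _ oz) _.
by rewrite sqr_sqrtr ?(ltW i0) // mulKf // pnatr_eq0.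
Qed.

Theorem corollary6p9 (R : realType) :
  [/\ markov_const R = 2 * Num.sqrt (1 + polar_const R ^+ 2)
    & 2 * Num.sqrt (1 + polar_const R ^+ 2) = 2 * Num.sqrt 5]
  /\
  [/\ max_of [set eucl (qgrad (Pstar R) z) | z in octa] =
        markov_const R * supnorm octa (qeval (Pstar R)),
      bilnorm (Pstar R) =
        polar_const R * supnorm octa (qeval (Pstar R)),
      (forall q : \bar R, (1 <= q)%E ->
         coef_norm q (Pstar R) =
           coef_const q * supnorm octa (qeval (Pstar R)))
      /\ coef_norm (4 / 3)%:E (Pstar R) =
           coef_const (4 / 3)%:E * supnorm octa (qeval (Pstar R)),
      supnorm octa (qeval (modulus (Pstar R))) =
        uncond_const R * supnorm octa (qeval (Pstar R))
    & supnorm octa (qeval (Pstar R)) = 1 /\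
      forall r : R, bohr_radius R < r ->
        1 < supnorm (dilate r octa) (qeval (modulus (Pstar R)))].
Proof.
rewrite supnorm_Pstar markov_constE polar_constE uncond_constE supnorm_modulus_Pstar.
rewrite bilnorm_Pstar !mulr1.
have -> : 1 + 2 ^+ 2 = 5 :> R by rewrite -natrX -natr1 addrC.
have coefE q : (1 <= q)%E -> coef_norm q (Pstar R) = coef_const q * 1.
  by move=> q1; rewrite mulr1 coef_constE.
do 2!split => //.
- apply: max_of_eq; first by exists (1, 0); [exact: octa10|exact: eucl_qgrad_Pstar].
  move=> _ [z oz <-].
  by have := eucl_qgrad_le _ (Pstar R) _ oz; rewrite supnorm_Pstar mulr1.
- by split=> //; rewrite -[LHS]mulr1 coef_constE ?mulr1 // lee_fin; lra.
- split=> // r hr; apply: lt_le_trans (supnorm_modulus_Pstar_dilate_ge _ r).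
  have r3 : Num.sqrt 3^-1 < r by exact: le_lt_trans (le_bohr_radius R) hr.
  have : Num.sqrt 3^-1 ^+ 2 < r ^+ 2.
    by apply: ltrXn2r; rewrite ?nnegrE ?sqrtr_ge0 //;
      exact: le_trans (sqrtr_ge0 _) (ltW r3).
  rewrite sqr_sqrtr ?invr_ge0 //; lra.
Qed.
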